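(* Let $p \in (0,1)$ and $\tilde p = 1 - p$, and let $d \geq 2$ be an integer. The series $$\sum_{n=0}^\infty \sum_{k=0}^n \left[ \binom{n}{k} p^k \tilde p^{\,n-k} \right]^d$$ diverges for $d \in \{2,3\}$ and converges for $d \ge 4$. *)

(* Defs.v *)
From mathcomp Require Import all_boot all_order all_algebra.
From mathcomp Require Import all_classical all_reals all_analysis.
Import Order.TTheory GRing.Theory Num.Theory numFieldNormedType.Exports.

Set Implicit Arguments.
Unset Strict Implicit.
Unset Printing Implicit Defensive.

Local Open Scope ring_scope.

Definition binom_pow_sum (R : realType) (p : R) (d n : nat) : R :=
  \sum_(0 <= k < n.+1) ('C(n, k)%:R * p ^+ k * (1 - p) ^+ (n - k)) ^+ d.

(* Main.v *)
(** Write [b n k] for the binomial mass and [v = n p (1 - p)] for its variance.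

    Divergence: by Chebyshev at least half of the mass lies on the O(sqrt n)
    indices [k] with [|k - n p| < M], where [M ^ 2] is of order [n]; convexity of
    the cube then gives [sum_k (b n k) ^ 3 >= const / n], and [b <= 1] gives the
    same bound for squares.

    Convergence: for [k <= n p] consecutive ratios satisfy
    [b n (k + j + 1) / b n (k + j) >= 1 - (j + 1) / v], so [b n (k + j)] stays above
    [b n k / 2] for about sqrt v steps. The total mass being 1, this forces
    [b n k = O(1 / sqrt n)], also for [k >= n p] by symmetry. Hence
    [sum_k (b n k) ^ 4 <= (max_k b n k) ^ 3 = O(n ^ (- 3 / 2))]. *)
Require Import Defs.
From mathcomp Require Import all_boot all_order all_algebra.
From mathcomp Require Import all_classical all_reals all_analysis.
From mathcomp Require Import ring lra.
Import Order.TTheory GRing.Theory Num.Theory numFieldNormedType.Exports.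

Set Implicit Arguments.
Unset Strict Implicit.
Unset Printing Implicit Defensive.

Local Open Scope ring_scope.

Definition binom_mass (R : realType) (p : R) (n k : nat) : R :=
  'C(n, k)%:R * p ^+ k * (1 - p) ^+ (n - k).

(** * Identities and moments of the binomial mass *)

Section BinomialMass.
Variables (R : realType) (p : R).
Local Notation b := (binom_mass p).

Lemma binom_mass_small n k : (n < k)%N -> b n k = 0.
Proof. by move=> nk; rewrite /binom_mass bin_small// !mul0r. Qed.

Lemma binom_mass_rev n k : (k <= n)%N -> binom_mass (1 - p) n (n - k) = b n k.
Proof.
move=> kn; rewrite /binom_mass bin_sub// subKn// (_ : 1 - (1 - p) = p); last by ring.
by rewrite -!mulrA [_ * p ^+ k]mulrC.
Qed.

Lemma binom_massS0 n : b n.+1 0 = (1 - p) * b n 0.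
Proof. by rewrite /binom_mass !bin0 !subn0 exprS; ring. Qed.

Lemma binom_massSS n k : b n.+1 k.+1 = p * b n k + (1 - p) * b n k.+1.
Proof.
rewrite /binom_mass binS natrD subSS exprS.
have [kn|nk] := ltnP k n; first by rewrite -(subnSK kn) exprS; ring.
by rewrite (bin_small (_ : n < k.+1)%N)//; ring.
Qed.

(** The ratio of consecutive masses with denominators cleared, so that it includes [k = n], where
    both sides vanish. *)
Lemma binom_mass_succ n k : (k <= n)%N ->
  k.+1%:R * (1 - p) * b n k.+1 = (n%:R - k%:R) * p * b n k.
Proof.
move=> kn; rewrite -natrB// /binom_mass.
have [lt_kn|nk] := ltnP k n; last first.
  have -> : k = n by apply/eqP; rewrite eqn_leq kn nk.
  by rewrite subnn bin_small//; ring.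
have H : k.+1%:R * 'C(n, k.+1)%:R = (n - k)%:R * 'C(n, k)%:R :> R.
  by rewrite -!natrM mul_bin_left.
rewrite -(subnSK lt_kn) (exprS (1 - p)) (exprS p).
transitivity ((k.+1%:R * 'C(n, k.+1)%:R) * p * p ^+ k * (1 - p) * (1 - p) ^+ (n - k.+1)).
  by ring.
by rewrite H (subnSK lt_kn); ring.
Qed.

(* Conditions on the last Bernoulli trial. *)
Lemma binom_mean_rec n (f : nat -> R) :
  \sum_(0 <= k < n.+2) b n.+1 k * f k =
  p * (\sum_(0 <= k < n.+1) b n k * f k.+1) +
  (1 - p) * (\sum_(0 <= k < n.+1) b n k * f k).
Proof.
rewrite big_nat_recl// binom_massS0.
under eq_bigr do rewrite binom_massSS mulrDl -(mulrA p) -(mulrA (1 - p)).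
rewrite big_split /= -!mulr_sumr.
rewrite [X in _ + (_ + _ * X)]big_nat_recr//= (binom_mass_small (ltnSn n)) mul0r addr0.
by rewrite [X in _ = _ + _ * X]big_nat_recl//; ring.
Qed.

Lemma binom_mass_sum n : \sum_(0 <= k < n.+1) b n k = 1.
Proof.
under eq_bigr do rewrite -[b n _]mulr1.
elim: n => [|n IH]; last by rewrite (binom_mean_rec n (fun=> 1)) IH; ring.
by rewrite big_nat1 /binom_mass bin0 subnn !expr0 !mulr1.
Qed.

(** The centre [c] is arbitrary because a success in the last trial shifts it to [c - 1] in the
    induction. *)
Lemma binom_second_moment n c :
  \sum_(0 <= k < n.+1) b n k * (k%:R - c) ^+ 2 =
  n%:R * p * (1 - p) + (n%:R * p - c) ^+ 2.
Proof.
elim: n c => [|n IH] c.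
  by rewrite big_nat1 /binom_mass bin0 subnn !expr0; ring.
rewrite (binom_mean_rec n (fun k => (k%:R - c) ^+ 2)) IH.
have E k : k.+1%:R - c = k%:R - (c - 1) by rewrite mulrSr; ring.
under eq_bigr do rewrite E.
by rewrite IH mulrSr; ring.
Qed.

(** * Decay and concentration of the mass *)

Hypotheses (p_gt0 : 0 < p) (p_lt1 : p < 1).

Lemma binom_mass_ge0 n k : 0 <= b n k.
Proof.
by rewrite /binom_mass !mulr_ge0 ?exprn_ge0 ?ler0n ?ltW// subr_gt0.
Qed.

Lemma binom_mass_run_le1 n k m : \sum_(0 <= j < m) b n (k + j) <= 1.
Proof.
rewrite -(binom_mass_sum n).
have -> : \sum_(0 <= j < m) b n (k + j) = \sum_(k <= i < k + m) b n i.
  by rewrite -{2}[k]add0n big_addn addKn; under [RHS]eq_bigr do rewrite addnC.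
(* The window may run past [n]; padding the total with zero masses makes it contain the window. *)
have E : \sum_(0 <= i < n.+1) b n i = \sum_(0 <= i < k + m + n.+1) b n i.
  rewrite [RHS](@big_cat_nat _ _ _ n.+1)//= ?leq_addl//.
  rewrite [X in _ = _ + X]big_nat [X in _ = _ + X]big1 ?addr0// => i /andP[ni _].
  exact: binom_mass_small.
rewrite E [leRHS](@big_cat_nat _ _ _ k)//= -?addnA ?leq_addr//.
rewrite [X in _ <= _ + X](@big_cat_nat _ _ _ (k + m))//= ?addnA ?leq_addr//.
rewrite addrCA lerDl addr_ge0// sumr_ge0// => i _; exact: binom_mass_ge0.
Qed.

Lemma binom_mass_le1 n k : b n k <= 1.
Proof. by have := binom_mass_run_le1 n k 1; rewrite big_nat1 addn0. Qed.

(** The product of the ratio bounds [1 - (i + 1) / v] over [i < j] is at least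
    [1 - j (j + 1) / (2 v)]; here this is multiplied by [2 v]. *)
Lemma binom_mass_run_ge n k j (v := n%:R * p * (1 - p)) : k%:R <= n%:R * p ->
  (2 * v - j%:R * (j%:R + 1)) * b n k <= 2 * v * b n (k + j).
Proof.
have vE : v = n%:R * p * (1 - p) by [].
clearbody v => k_le; have q_gt0 : 0 < 1 - p by rewrite subr_gt0.
have v_ge0 : 0 <= v by rewrite vE !mulr_ge0 ?ler0n// ltW.
elim: j => [|j IH]; first by rewrite addn0 mul0r subr0.
have j_ge0 : 0 <= j%:R :> R := ler0n _ _.
have jS : j.+1%:R = j%:R + 1 :> R by rewrite mulrSr.
have b_ge0 i : 0 <= b n i := binom_mass_ge0 n i.
(* If [v < j + 1], the new left coefficient [2 v - (j + 1) (j + 2)] is nonpositive. *)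
have [j_le|j_gt] := leP (j%:R + 1) v; last first.
  rewrite jS; apply: (@le_trans _ _ 0).
    by rewrite mulr_le0_ge0//; move: (mulr_ge0 j_ge0 j_ge0); lra.
  by rewrite mulr_ge0 ?b_ge0// mulr_ge0.
have kj_le : (k + j <= n)%N.
  rewrite -(ler_nat R) natrD; have : v <= n%:R * (1 - p); last by lra.
  by rewrite vE mulrAC ler_piMr ?mulr_ge0 ?ler0n// ltW.
have step : (v - (j%:R + 1)) * b n (k + j) <= v * b n (k + j.+1).
  have D_gt0 : 0 < (k%:R + j%:R + 1) * (1 - p) by rewrite mulr_gt0// ltr_wpDl// addr_ge0.
  have := binom_mass_succ kj_le; rewrite addnS mulrSr natrD => succE.
  rewrite -(ler_pM2l D_gt0) [leRHS]mulrCA succE [leLHS]mulrA [leRHS]mulrA ler_wpM2r//.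
  have D_le : (k%:R + j%:R + 1) * (1 - p) <= v + (j%:R + 1) * (1 - p).
    by rewrite vE; move: (ler_wpM2r (ltW q_gt0) k_le); lra.
  have num_ge : v - p * j%:R <= (n%:R - (k%:R + j%:R)) * p.
    by rewrite vE; move: (ler_wpM2l (ltW p_gt0) k_le); lra.
  rewrite (@le_trans _ _ ((v + (j%:R + 1) * (1 - p)) * (v - (j%:R + 1))))//.
    by rewrite ler_wpM2r// subr_ge0.
  rewrite (@le_trans _ _ (v * (v - p * j%:R)))//; last by rewrite ler_wpM2l.
  (* The difference of the two products is exactly [v p + (j + 1) ^ 2 (1 - p)]. *)
  have : 0 <= v * p by rewrite mulr_ge0// ltW.
  have : 0 <= (j%:R + 1) ^+ 2 * (1 - p) by rewrite mulr_ge0 ?sqr_ge0// ltW.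
  by lra.
rewrite jS.
have [v0|v_gt0] := eqVneq v 0; first by lra.
have {}v_gt0 : 0 < v by rewrite lt_def v_gt0.
rewrite -(ler_pM2l v_gt0).
(* Multiplying the coefficients gains exactly [j (j + 1) ^ 2] over the target. *)
apply: (@le_trans _ _ ((v - (j%:R + 1)) * ((2 * v - j%:R * (j%:R + 1)) * b n k))).
  rewrite [leLHS]mulrA [leRHS]mulrA ler_wpM2r//.
  have : 0 <= j%:R * (j%:R + 1) ^+ 2 :> R by rewrite mulr_ge0 ?sqr_ge0.
  by lra.
apply: (@le_trans _ _ ((v - (j%:R + 1)) * (2 * v * b n (k + j)))).
  by rewrite ler_wpM2l ?subr_ge0.
by rewrite mulrCA [leRHS]mulrCA ler_wpM2l ?mulr_ge0.
Qed.

(** With [m] the integer part of [sqrt v], each [j < m] has [j (j + 1) <= v], so [m] masses are at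
    least [b n k / 2] and [m b <= 2]. Adding [b <= 1] gives [(m + 1) b <= 3], whence [9]. *)
Lemma binom_mass_max_below n k : k%:R <= n%:R * p ->
  b n k ^+ 2 * (n%:R * p * (1 - p)) <= 9.
Proof.
set v := n%:R * p * (1 - p) => k_le.
have v_ge0 : 0 <= v by rewrite !mulr_ge0 ?ler0n// ?subr_ge0 ltW.
have [->|v_neq0] := eqVneq v 0; first by rewrite mulr0.
have v_gt0 : 0 < v by rewrite lt_def v_neq0.
pose m := Num.truncn (Num.sqrt v).
have /andP[m_le m_gt] := truncn_itv (sqrtr_ge0 v); rewrite -/m in m_le m_gt.
have m2_le : m%:R ^+ 2 <= v by rewrite -(sqr_sqrtr v_ge0) ler_sqr ?nnegrE ?sqrtr_ge0.
have v_le : v <= (m%:R + 1) ^+ 2.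
  by rewrite -(sqr_sqrtr v_ge0) -mulrSr ler_sqr ?nnegrE ?sqrtr_ge0// ltW.
have b_ge0 := binom_mass_ge0 n k; have b_le1 := binom_mass_le1 n k.
have bm_le : b n k * m%:R <= 2.
  have := binom_mass_run_le1 n k m.
  rewrite -(@ler_pM2l _ 2)// mulr1; apply: le_trans.
  rewrite mulr_sumr mulr_natr -[X in _ *+ X]subn0 -sumr_const_nat.
  apply: ler_sum_nat => j /andP[_ jm].
  rewrite -(ler_pM2l v_gt0) [leRHS]mulrA [v * 2]mulrC.
  apply: le_trans (binom_mass_run_ge j k_le); rewrite ler_wpM2r// -/v.
  have jSm : j%:R + 1 <= m%:R :> R by rewrite -mulrSr ler_nat.
  have j_ge0 : 0 <= j%:R :> R := ler0n _ _.
  by nra.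
apply: (@le_trans _ _ ((b n k * m%:R + b n k) ^+ 2)).
  rewrite (_ : b n k * m%:R + b n k = b n k * (m%:R + 1)); last by ring.
  by rewrite [leRHS]exprMn ler_wpM2l ?sqr_ge0.
have -> : 9 = 3 ^+ 2 :> R by ring.
have s_ge0 : 0 <= b n k * m%:R + b n k by rewrite addr_ge0 // mulr_ge0.
by rewrite ler_sqr ?nnegrE//; lra.
Qed.

Lemma binom_mass_exp_anti n k d e : (d <= e)%N -> b n k ^+ e <= b n k ^+ d.
Proof. by move=> de; rewrite ler_wiXn2l ?binom_mass_ge0 ?binom_mass_le1. Qed.

(** Chebyshev: the indicator of the near indices dominates [1 - (k - n p) ^ 2 / M ^ 2]. Using [n.+1]
    keeps [M] positive even for [n = 0]. *)
Lemma binom_mass_near_ge n M : 2 * n.+1%:R <= M%:R ^+ 2 :> R ->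
  2^-1 <= \sum_(0 <= k < n.+1 | `|k%:R - n%:R * p| < M%:R) b n k.
Proof.
move=> M_ge; have M2_gt0 : 0 < M%:R ^+ 2 :> R.
  by apply: lt_le_trans M_ge; rewrite mulr_gt0.
have pq_le : n%:R * p * (1 - p) <= n.+1%:R.
  have np_le : n%:R * p <= n%:R by rewrite ler_piMr// ltW.
  have np_ge0 : 0 <= n%:R * p by rewrite mulr_ge0// ltW.
  have : n%:R * p * (1 - p) <= n%:R * p by rewrite ler_piMr// gerBl ltW.
  by rewrite mulrSr; lra.
have var_le : (M%:R ^+ 2)^-1 * (n%:R * p * (1 - p)) <= 2^-1.
  by rewrite mulrC ler_pdivrMr//; lra.
apply: (@le_trans _ _ (\sum_(0 <= k < n.+1)
    (b n k - (M%:R ^+ 2)^-1 * (b n k * (k%:R - n%:R * p) ^+ 2)))).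
  rewrite sumrB -mulr_sumr binom_mass_sum binom_second_moment subrr.
  by rewrite expr0n /= addr0; lra.
rewrite [leRHS]big_mkcond /=; apply: ler_sum => k _.
have b_ge0 := binom_mass_ge0 n k.
case: ltP => [_|M_le].
  by rewrite gerBl mulr_ge0 ?invr_ge0 ?(ltW M2_gt0)// mulr_ge0 ?sqr_ge0.
rewrite subr_le0 mulrC -mulrA ler_peMr// ler_pdivlMr// mul1r.
by rewrite -[leRHS]real_normK ?num_real// lerXn2r ?nnegrE.
Qed.

End BinomialMass.

(** * Rates in [n]: the sum of cubes from below, the largest mass from above *)

(** All selected indices lie less than [2 M] above the smallest one, [k0], hence in an integer range
    of length [2 M]. *)
Lemma count_near_le (R : realType) (x : R) (n M : nat) :
  (count (fun k : nat => `|k%:R - x| < M%:R)%R (iota 0 n) <= 2 * M)%N.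
Proof.
rewrite -size_filter; set P := fun k : nat => `|k%:R - x| < M%:R.
case E : [seq k <- iota 0 n | P k] => [//|k0 s].
have mem_P k : k \in k0 :: s -> P k by rewrite -E mem_filter => /andP[].
have k0_sorted : sorted leq (k0 :: s).
  by rewrite -E sorted_filter ?iota_sorted//; exact: leq_trans.
have /allP k0_min := order_path_min leq_trans k0_sorted.
rewrite -(size_iota k0 (2 * M)) uniq_leq_size//.
  by rewrite -E filter_uniq// iota_uniq.
move=> k ks; rewrite mem_iota; apply/andP; split.
  by move: ks; rewrite inE => /predU1P[->//|/k0_min].
rewrite -(ltr_nat R) natrD natrM.
have := mem_P _ ks; have := mem_P _ (mem_head _ _).
by rewrite /P !ltr_norml => /andP[? ?] /andP[? ?]; lra.
Qed.

(** Mass [1 / 2] spread evenly over [2 M] indices, the worst case, puts [1 / (4 M)] on each; this is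
    the tangent point [a]. *)
Lemma binom_cube_sum_ge (R : realType) (p : R) (n : nat) : 0 < p -> p < 1 ->
  288^-1 * harmonic n <= \sum_(0 <= k < n.+1) binom_mass p n k ^+ 3.
Proof.
move=> p_gt0 p_lt1.
pose r : R := Num.sqrt (2 * n.+1%:R); pose M := (Num.truncn r).+1.
have r_ge0 : 0 <= r := sqrtr_ge0 _.
have r2 : r ^+ 2 = 2 * n.+1%:R by rewrite sqr_sqrtr// mulr_ge0.
have n_ge1 : 1 <= n.+1%:R :> R by rewrite ler1n.
have /andP[r_ge r_lt] := truncn_itv r_ge0.
have r_le : r <= M%:R := ltW r_lt.
have M_le : M%:R <= r + 1 by rewrite mulrSr lerD2r.
have M_gt0 : 0 < M%:R :> R by rewrite ltr0n.
have M2_ge : 2 * n.+1%:R <= M%:R ^+ 2 :> R by rewrite -r2 lerXn2r ?nnegrE// ltW.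
have M2_le : M%:R ^+ 2 <= 9 * n.+1%:R :> R.
  have : M%:R ^+ 2 <= (r + 1) ^+ 2 by rewrite lerXn2r ?nnegrE ?addr_ge0 ?(ltW M_gt0).
  by have := sqr_ge0 (r - 1); lra.
have b_ge0 k := binom_mass_ge0 p_gt0 p_lt1 n k.
pose P := fun k : nat => `|k%:R - n%:R * p| < M%:R.
(* Tangent to [x ^ 3] at [a = 1 / (4 M)]: [x ^ 3 >= 3 a ^ 2 x - 2 a ^ 3]. *)
pose a : R := (4 * M%:R)^-1.
have a_gt0 : 0 < a by rewrite invr_gt0 mulr_gt0.
have near_ge := binom_mass_near_ge p_gt0 p_lt1 M2_ge.
have count_le : (count P (index_iota 0 n.+1))%:R <= 2 * M%:R :> R.
  by rewrite -natrM ler_nat /index_iota subn0 count_near_le.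
apply: (@le_trans _ _ (\sum_(0 <= k < n.+1 | P k)
    (3 * a ^+ 2 * binom_mass p n k - 2 * a ^+ 3))); last first.
  apply: (@le_trans _ _ (\sum_(0 <= k < n.+1 | P k) binom_mass p n k ^+ 3)).
    apply: ler_sum => k _; have := b_ge0 k; set x := binom_mass p n k => x_ge0.
    have : 0 <= (x - a) ^+ 2 * (x + 2 * a).
      by rewrite mulr_ge0 ?sqr_ge0// addr_ge0// mulr_ge0// ltW.
    by lra.
  by rewrite [leRHS](bigID P) /= lerDl sumr_ge0// => k _; rewrite exprn_ge0.
rewrite sumrB -mulr_sumr big_const_seq iter_addr_0 -mulr_natr.
have a3M : a ^+ 3 * M%:R = a ^+ 2 / 4 by rewrite /a; field; rewrite gt_eqF.
(* The tangent bound is at least [3 a ^ 2 / 2 - 4 M a ^ 3 = a ^ 2 / 2 = 1 / (32 M ^ 2)], and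
   [288 = 32 * 9]. *)
apply: (@le_trans _ _ (a ^+ 2 / 2)).
  have -> : a ^+ 2 / 2 = (32 * M%:R ^+ 2)^-1 by rewrite /a; field; rewrite gt_eqF.
  rewrite /harmonic /= -invfM lef_pV2 ?posrE ?mulr_gt0 ?exprn_gt0//.
  by lra.
have := ler_wpM2l (sqr_ge0 a) near_ge.
have := ler_wpM2l (exprn_ge0 3 (ltW a_gt0)) count_le.
by rewrite -/P; lra.
Qed.

(** Passing from [n] to [n.+1], which allows division at [n = 0], costs at most [1]: hence [9 + 1].
    Indices above the mean are reflected by exchanging [p] and [1 - p]. *)
Lemma binom_mass_max (R : realType) (p : R) (n k : nat) : 0 < p -> p < 1 ->
  binom_mass p n k ^+ 2 * (n.+1%:R * (p * (1 - p))) <= 10.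
Proof.
move=> p_gt0 p_lt1; have q_gt0 : 0 < 1 - p by rewrite subr_gt0.
have q_lt1 : 1 - p < 1 by rewrite gtrBl.
have b2_le1 : binom_mass p n k ^+ 2 <= 1.
  by rewrite exprn_ile1 ?binom_mass_ge0 ?binom_mass_le1.
have pq_ge0 : 0 <= p * (1 - p) by rewrite mulr_ge0 ?ltW.
have pq_le1 : p * (1 - p) <= 1 by rewrite mulr_ile1 ?ltW.
have b2_ge0 := sqr_ge0 (binom_mass p n k).
have b2pq_le1 : binom_mass p n k ^+ 2 * (p * (1 - p)) <= 1 by rewrite mulr_ile1.
suff : binom_mass p n k ^+ 2 * (n%:R * p * (1 - p)) <= 9 by rewrite mulrSr; lra.
have [k_le|k_gt] := lerP k%:R (n%:R * p); first exact: binom_mass_max_below.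
have [kn|nk] := leqP k n; last by rewrite binom_mass_small// expr0n mul0r.
rewrite -binom_mass_rev//.
have -> : n%:R * p * (1 - p) = n%:R * (1 - p) * (1 - (1 - p)) by ring.
by apply: binom_mass_max_below => //; rewrite natrB//; lra.
Qed.

(** * Comparison of the series *)

Theorem theorem2 (R : realType) (p : R) (d : nat)
    (p_gt0 : 0 < p) (p_lt1 : p < 1) (d_ge2 : (2 <= d)%N) :
  (d = 2%N \/ d = 3%N -> ~ cvgn (series (binom_pow_sum p d))) /\
  ((4 <= d)%N -> cvgn (series (binom_pow_sum p d))).
Proof.
have u_ge0 n : 0 <= binom_pow_sum p d n.
  by apply: sumr_ge0 => k _; rewrite exprn_ge0// binom_mass_ge0.
have u_anti e e' n : (e <= e')%N -> binom_pow_sum p e' n <= binom_pow_sum p e n.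
  by move=> ee'; apply: ler_sum => k _; exact: binom_mass_exp_anti.
split=> [d23 cvg_u|d_ge4].
  apply: (@dvg_harmonic R).
  have -> : harmonic = (288 : R) *: ((288^-1 : R) *: @harmonic R).
    by rewrite scalerA divff// scale1r.
  apply: is_cvg_seriesZ; apply: series_le_cvg cvg_u => // n.
    by rewrite mulr_ge0 ?invr_ge0.
  apply: le_trans (binom_cube_sum_ge n p_gt0 p_lt1) _.
  by apply: (u_anti d 3%N n); case: d23 => ->.
pose s n : R := Num.sqrt n.+1%:R; pose c : R := Num.sqrt (10 / (p * (1 - p))).
have s_gt0 n : 0 < s n by rewrite sqrtr_gt0.
have s2 n : s n ^+ 2 = n.+1%:R by rewrite sqr_sqrtr.
have pq_gt0 : 0 < p * (1 - p) by rewrite mulr_gt0 ?subr_gt0.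
have c_ge0 : 0 <= c := sqrtr_ge0 _.
have b_le n k : binom_mass p n k <= c / s n.
  rewrite -ler_sqr ?nnegrE ?binom_mass_ge0 ?divr_ge0 ?(ltW (s_gt0 _))//.
  rewrite expr_div_n s2 sqr_sqrtr ?divr_ge0 ?(ltW pq_gt0)//.
  rewrite ler_pdivlMr// ler_pdivlMr// -mulrA.
  exact: binom_mass_max.
pose t n : R := (s n)^-1.
(* [n ^ (- 3 / 2)] is dominated by the telescoping differences of [n ^ (- 1 / 2)]. *)
have t_le n : t n ^+ 3 <= 6 * (t n - t n.+1).
  have x_gt0 := s_gt0 n; have y_gt0 := s_gt0 n.+1.
  have y2 : s n.+1 ^+ 2 = s n ^+ 2 + 1 by rewrite !s2 mulrSr.
  have x_ge1 : 1 <= s n by rewrite -sqrtr1 ler_wsqrtr// ler1n.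
  have y_le : s n.+1 <= 2 * s n.
    rewrite -ler_sqr ?nnegrE ?mulr_ge0 ?ltW// exprMn y2.
    by have := exprn_ege1 2 x_ge1; lra.
  (* With [x = s n] and [y = s n.+1], the difference is [1 / (x y (x + y))], and [y <= 2 x] bounds
     the denominator by [6 x ^ 3]. *)
  rewrite /t; have -> : (s n)^-1 - (s n.+1)^-1 =
      (s n.+1 ^+ 2 - s n ^+ 2) / (s n * s n.+1 * (s n + s n.+1)).
    by field; rewrite !gt_eqF// addr_gt0.
  rewrite y2 addrAC subrr add0r div1r exprVn ler_pdivlMr ?mulr_gt0 ?addr_gt0//.
  rewrite mulrC ler_pdivrMr ?exprn_gt0//.
  have -> : 6 * s n ^+ 3 = s n * (2 * s n) * (s n + 2 * s n) by ring.
  by rewrite ler_pM ?lerD2l ?mulr_ge0 ?addr_ge0 ?ler_wpM2l// ltW.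
have t_dec n : t n.+1 <= t n.
  by rewrite lef_pV2 ?posrE// ler_wsqrtr// ler_nat.
have t_ge0 n : 0 <= t n by rewrite invr_ge0 ltW.
pose v : R ^nat := (c ^+ 3 * 6) *: - telescope t.
have vE n : v n = c ^+ 3 * (6 * (t n - t n.+1)).
  by rewrite mulrA -(opprB (t n.+1)).
apply: (@series_le_cvg _ _ v) => // [n|n|].
- by rewrite vE !mulr_ge0 ?exprn_ge0// subr_ge0.
- apply: le_trans (u_anti 4%N d n d_ge4) _; rewrite vE.
  apply: (@le_trans _ _ ((c / s n) ^+ 3)); last first.
    by rewrite [leLHS]exprMn ler_wpM2l ?exprn_ge0//; exact: t_le.
  (* Three factors are bounded by [c / s n]; the fourth is kept and sums to [1]. *)
  rewrite -[leRHS]mulr1 -(binom_mass_sum p n) mulr_sumr; apply: ler_sum => k _.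
  have b_ge0 := binom_mass_ge0 p_gt0 p_lt1 n k.
  rewrite -/(binom_mass p n k) exprSr ler_wpM2r// lerXn2r ?nnegrE//.
  by rewrite divr_ge0// ltW.
(* The telescoped partial sums are [t n - t 0], and [t] is nonincreasing and nonnegative. *)
apply: is_cvg_seriesZ; rewrite is_cvg_seriesN telescopeK.
apply: is_cvgB; last exact: is_cvg_cst.
apply: nonincreasing_is_cvgn; first by apply/nonincreasing_seqP.
by exists 0 => _ [n _ <-].
Qed.
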